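(* Let $\mathcal C$ be a binary linear $[n,k,d]$ code with $k>0.78n$, and let $0<\delta\le1$. The BCJL bit-commitment scheme (described in the context) with code $\mathcal C$ is $$\bigl(2^{\frac12(q-d/2+\delta n+h(\delta)n)}+2\cdot 2^{-\delta n}\bigr)\text{-binding}$$ against $q$-quantum-memory-bounded projective adversaries.
   Context: Notation: $h(\delta)=-\delta\log_2\delta-(1-\delta)\log_2(1-\delta)$ with $h(1)=0$. For $b\in\{0,1\}$, $|b\rangle_+$ is the computational basis vector $|b\rangle$, and $|0\rangle_\times=\frac1{\sqrt2}(|0\rangle+|1\rangle)$, $|1\rangle_\times=\frac1{\sqrt2}(|0\rangle-|1\rangle)$; for $x\in\{0,1\}^n$, $\theta\in\{+,\times\}^n$, $|x\rangle_\theta=\bigotimes_i|x_i\rangle_{\theta_i}$. The syndrome of $v\in\{0,1\}^n$ for $\mathcal C$ is $Hv$ for a fixed parity check matrix $H$ of $\mathcal C$; $d$ is the minimum distance. BCJL scheme. Commit($b$): Alice chooses uniformly random $x\in\{0,1\}^n$ and $\theta\in\{+,\times\}^n$ and sends $|x\rangle_\theta$ to Bob; Bob chooses uniformly random $\hat\theta\in\{+,\times\}^n$ and measures the qubits in basis $\hat\theta$, with result $\hat x$; Alice chooses $g$ at random from a two-universal family $\mathcal G_n$ of functions $\{0,1\}^n\to\{0,1\}$ (i.e. $\Pr_g[g(u)=g(v)]\le\frac12$ for $u\ne v$), computes the syndrome $s$ of $x$, and sends $w=g(x)\oplus b$, $g$ and $s$ to Bob. Reveal: Alice sends $x,\theta,b$;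 Bob accepts iff $x$ has syndrome $s$, $\hat x_i=x_i$ for every $i$ with $\hat\theta_i=\theta_i$, and $g(x)\oplus w=b$. Binding: the (dishonest) committer sends an $n$-qubit register $B$ and a classical message $(w,g,s)$ and keeps a register $A$. For fixed $(w,g,s)$, the openings to $b$ are the pairs $(x,\theta)$ with $x$ of syndrome $s$ and $g(x)\oplus w=b$; let $V_{x,\theta}$ be the POVM element on $B$ such that $\mathrm{tr}(V_{x,\theta}\rho_B)$ is the probability (over $\hat\theta$ and the measurement) that honest Bob, given register $B$ in state $\rho_B$, accepts the opening $(x,\theta)$. The scheme is $\epsilon$-binding against $q$-quantum-memory-bounded ($q$-QMB) projective adversaries if for all states $\rho_{AB}$ with $\dim(\mathcal H_A)\le 2^q$ and all $(w,g,s)$, $P_0^A(\rho_{AB})+P_1^A(\rho_{AB})\le1+\epsilon$, where $P_b^A(\rho_{AB})=\max\sum_{y}\mathrm{tr}((\mathbb F_y\otimes V_y)\rho_{AB})$, the sum being over openings $y=(x,\theta)$ to $b$ and the maximum over all projective measurements $\{\mathbb F_y\}_y$ on $A$ (mutually orthogonal projectors summing to the identity), with the convention $P_b^A=0$ if there is no opening to $b$. *)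

(* Defs.v *)
From HB Require Import structures.
From mathcomp Require Import all_boot all_order all_algebra.
From mathcomp Require Import complex mxtens.
From mathcomp Require Import boolp classical_sets reals exp.

Set Implicit Arguments.
Unset Strict Implicit.
Unset Printing Implicit Defensive.

Import Order.TTheory GRing.Theory Num.Theory.
Local Open Scope sesquilinear_scope.
Local Open Scope complex_scope.
Local Open Scope ring_scope.

(* {0,1}^n is 'rV['F_2]_n, and XOR is addition in 'F_2. *)
Notation bits n := 'rV['F_2]_n.

(* A basis string in {+, x}^n: false is the computational basis +,
   true is the diagonal basis x. *)
Notation bases n := {ffun 'I_n -> bool}.

Section Codes.
Variable n : nat.

Definition hamming_dist (u v : bits n) : nat := #|[set i | u 0 i != v 0 i]|.

Definition min_distance (C : {vspace bits n}) (d : nat) : Prop :=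
  (exists u v, [/\ u \in C, v \in C, u != v & hamming_dist u v = d]) /\
  (forall u v, u \in C -> v \in C -> u != v -> (d <= hamming_dist u v)%N).

Definition linear_code (C : {vspace bits n}) (k d : nat) : Prop :=
  \dim C = k /\ min_distance C d.

Definition syndrome r (H : 'M['F_2]_(r, n)) (v : bits n) : 'cV['F_2]_r :=
  H *m v^T.

(* The rows of H are not required to be linearly independent. *)
Definition parity_check r (C : {vspace bits n}) (H : 'M['F_2]_(r, n)) : Prop :=
  forall v, (v \in C) = (syndrome H v == 0).

(* The family is indexed by a finite type I, whose index is drawn uniformly. *)
Definition two_universal (R : realType) (I : finType)
    (g : I -> bits n -> 'F_2) : Prop :=
  (0 < #|I|)%N /\
  forall u v, u != v ->
    #|[set i | g i u == g i v]|%:R / #|I|%:R <= 2^-1 :> R.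

End Codes.

Section Quantum.
Variable R : realType.

Definition psd_mx m (A : 'M[R[i]]_m) : Prop :=
  A ^t* = A /\ forall v : 'cV[R[i]]_m, 0 <= (v ^t* *m A *m v) 0 0.

Definition density_mx m (rho : 'M[R[i]]_m) : Prop :=
  psd_mx rho /\ \tr rho = 1.

(* Outcomes range over Y only; F y is irrelevant for y outside Y. *)
Definition projective_measurement (T : finType) (Y : {set T}) a
    (F : T -> 'M[R[i]]_a) : Prop :=
  [/\ forall y, y \in Y -> (F y) ^t* = F y /\ F y *m F y = F y,
      forall y z, y \in Y -> z \in Y -> y != z -> F y *m F z = 0 &
      \sum_(y in Y) F y = 1%:M].

Definition qubit_ket (t : bool) (b : 'F_2) : 'cV[R[i]]_2 :=
  if t then (Num.sqrt 2)^-1%:C *: (delta_mx 0 0 + (-1) ^+ b *: delta_mx 1 0)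
  else delta_mx b 0.

(* n qubits: the computational basis of C^(2^n) is enumerated by enum_val on
   bit strings, #|bits n| = 2^n; the z-th coordinate of |x>_theta is
   \prod_i <z_i | x_i>_{theta_i}. *)
Definition qubits_ket n (x : bits n) (theta : bases n) :
    'cV[R[i]]_#|{: bits n}| :=
  \col_k \prod_i qubit_ket (theta i) (x 0 i) ((enum_val k : bits n) 0 i) 0.

End Quantum.

Section BCJL.
Variables (R : realType) (n r : nat) (H : 'M['F_2]_(r, n)).
Variables (I : finType) (g : I -> bits n -> 'F_2).

(* Bob's commit-phase message is (w, j, s), where j is the index of the hash
   function; an opening of b is a pair (x, theta). *)
Definition openings (w : 'F_2) (j : I) (s : 'cV['F_2]_r) (b : 'F_2) :
    {set bits n * bases n} :=
  [set y | (syndrome H y.1 == s) && (g j y.1 + w == b)].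

Definition bob_accepts (w : 'F_2) (j : I) (s : 'cV['F_2]_r) (b : 'F_2)
    (y : bits n * bases n) (thetahat : bases n) (xhat : bits n) : bool :=
  (y \in openings w j s b) &&
  [forall i, (thetahat i == y.2 i) ==> (xhat 0 i == y.1 0 i)].

(* By the Born rule, Bob measuring in basis thetahat obtains xhat with
   probability \tr (|xhat><xhat|_thetahat *m rho_B); bob_povm collects the
   accepting outcomes, averaged over the 2^n equiprobable choices of thetahat. *)
Definition bob_povm (w : 'F_2) (j : I) (s : 'cV['F_2]_r) (b : 'F_2)
    (y : bits n * bases n) : 'M[R[i]]_#|{: bits n}| :=
  (2 ^+ n)^-1 *:
  \sum_(thetahat : bases n) \sum_(xhat | bob_accepts w j s b y thetahat xhat)
     qubits_ket R xhat thetahat *m (qubits_ket R xhat thetahat) ^t*.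

Definition success a (rho : 'M[R[i]]_(a * #|{: bits n}|)) w j s b
    (F : bits n * bases n -> 'M[R[i]]_a) : R :=
  complex.Re (\sum_(y in openings w j s b)
    \tr ((F y *t bob_povm w j s b y) *m rho)).

(* The maximum is rendered by sup, over a set bounded by 1 when rho is a
   density matrix (and attained, by compactness). *)
Definition opening_prob a (rho : 'M[R[i]]_(a * #|{: bits n}|)) w j s b : R :=
  if openings w j s b == finset.set0 then 0
  else sup [set p | exists F, projective_measurement (openings w j s b) F /\
                              p = success rho w j s b F]%classic.

Definition bcjl_binding (q eps : R) : Prop :=
  forall (a : nat) (rho : 'M[R[i]]_(a * #|{: bits n}|)),
    a%:R <= 2 `^ q -> density_mx rho ->
    forall (w : 'F_2) (j : I) (s : 'cV['F_2]_r),
      opening_prob rho w j s 0 + opening_prob rho w j s 1 <= 1 + eps.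

End BCJL.

Definition log2 (R : realType) (t : R) : R := ln t / ln 2.

(* 0 * log2 0 = 0, so that binary_entropy 1 = 0. *)
Definition binary_entropy (R : realType) (t : R) : R :=
  - t * log2 t - (1 - t) * log2 (1 - t).

(* Main.v *)
Require Import Defs.
From mathcomp Require Import all_boot all_order all_algebra.
From mathcomp Require Import complex mxtens.
From mathcomp Require Import boolp classical_sets reals sequences exp.
From mathcomp Require Import ring lra.

(* Averaging over Bob's basis gives V_(x,theta) = \sum_u 2^-dist(u,x)
   |u><u|_theta, so up to a tail of at most 2^(- delta n) Bob projects onto the
   Hamming ball of radius delta n around x, in the basis theta. Write A and B
   for the projectors \sum_y F_y (x) Pi_y of the openings to 0 and to 1; then
   P_0 + P_1 <= 1 + ||A B|| up to the two tails. Openings to different bits have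
   strings at distance at least d, hence points of their balls are at distance
   at least d - 2 delta n and the corresponding kets overlap by at most
   2^(delta n - d/2), in whatever bases. Since the squared Frobenius norms of
   the products F_y G_z add up to dim A <= 2^q, Cauchy-Schwarz yields
   ||A B||^2 <= 2^q (2^(delta n - d/2) |ball|)^2 <= 2^(q + 2 e), where
   e = h(delta) n + delta n - d/2. The claim is that P_0 + P_1 is at most
   1 + 2^((q + e)/2) up to the tails: this is weaker when e < 0, and trivial
   when e >= 0. *)

Set Implicit Arguments.
Unset Strict Implicit.
Unset Printing Implicit Defensive.

Import Order.TTheory GRing.Theory Num.Theory.
Local Open Scope sesquilinear_scope.
Local Open Scope complex_scope.
Local Open Scope ring_scope.

Import Normc.

(** * Frobenius norm *)

Section RealSums.
Variable R : realFieldType.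

(** Cauchy-Schwarz, from the nonnegativity in [t] of the quadratic \sum_i (a_i t + b_i)^2. *)
Lemma sum_mul_sqr_le (I : finType) (P : pred I) (a b : I -> R) :
  (\sum_(i | P i) a i * b i) ^+ 2 <=
  (\sum_(i | P i) a i ^+ 2) * (\sum_(i | P i) b i ^+ 2).
Proof.
set x := \sum_(i | _) _ * _; set y := \sum_(i | _) a i ^+ 2.
set z := \sum_(i | _) b i ^+ 2.
have y0 : 0 <= y by apply: sumr_ge0 => i _; exact: sqr_ge0.
have quad t : 0 <= y * t ^+ 2 + x * t *+ 2 + z.
  have -> : y * t ^+ 2 + x * t *+ 2 + z = \sum_(i | P i) (a i * t + b i) ^+ 2.
    rewrite /x /y /z !mulr_suml -sumrMnl -!big_split /=.
    by apply: eq_bigr => i _; ring.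
  by apply: sumr_ge0 => i _; exact: sqr_ge0.
have [y_eq0|y_neq0] := eqVneq y 0.
  have a0 i : P i -> a i = 0.
    move=> Pi; apply/eqP; rewrite -sqrf_eq0; apply: contraTT isT => ai.
    have := psumr_eq0P (fun i _ => sqr_ge0 (a i)) y_eq0 Pi.
    by move/eqP; rewrite (negPf ai).
  by rewrite /x big1 ?y_eq0 ?mul0r ?expr0n // => i Pi; rewrite a0 ?mul0r.
have y_gt0 : 0 < y by rewrite lt_def y_neq0.
(* This is the minimiser of the quadratic. *)
have := quad (- x / y).
have -> : y * (- x / y) ^+ 2 + x * (- x / y) *+ 2 + z = z - x ^+ 2 / y.
  by field.
by rewrite subr_ge0 ler_pdivrMr // mulrC.
Qed.

End RealSums.

Section Frobenius.
Variable R : realType.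
Local Notation C := R[i].

Lemma conj_mul_normc (z : C) : Num.conj z * z = (normc z ^+ 2)%:C.
Proof.
by rewrite rmorphXn /= mulrC -sqr_normc.
Qed.

Lemma normc_ge0 (z : C) : 0 <= normc z.
Proof. by case: z => a b; exact: sqrtr_ge0. Qed.

Lemma normc_conj (z : C) : normc (Num.conj z) = normc z.
Proof. by case: z => a b /=; rewrite sqrrN. Qed.

Lemma Re_le_normc (z : C) : complex.Re z <= normc z.
Proof.
have := normc_ge_Re z; rewrite -[`|z|]/((normc z)%:C) lecR.
exact/le_trans/ler_norm.
Qed.

Lemma normc_sum (I : finType) (P : pred I) (z : I -> C) :
  normc (\sum_(i | P i) z i) <= \sum_(i | P i) normc (z i).
Proof.
rewrite -lecR rmorph_sum /=.
exact: (@ler_norm_sum C C).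
Qed.

(** The square of the Frobenius norm, kept real-valued so that it can be ordered and put under
    square roots. *)
Definition fro m n (A : 'M[C]_(m, n)) : R := \sum_i \sum_j normc (A i j) ^+ 2.

Lemma fro_ge0 m n (A : 'M[C]_(m, n)) : 0 <= fro A.
Proof. by apply: sumr_ge0 => i _; apply: sumr_ge0 => j _; exact: sqr_ge0. Qed.

Lemma adjM m n p (A : 'M[C]_(m, n)) (B : 'M[C]_(n, p)) :
  (A *m B)^t* = B^t* *m A^t*.
Proof. by rewrite trmx_mul map_mxM. Qed.

Lemma adjD m n (A B : 'M[C]_(m, n)) : (A + B)^t* = A^t* + B^t*.
Proof. by rewrite raddfD /= raddfD. Qed.

Lemma adj_sum m n (I : finType) (P : pred I) (A : I -> 'M[C]_(m, n)) :
  (\sum_(i | P i) A i)^t* = \sum_(i | P i) (A i)^t*.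
Proof. by rewrite raddf_sum /= raddf_sum. Qed.

Lemma adj_tens m n p q (A : 'M[C]_(m, n)) (B : 'M[C]_(p, q)) :
  (A *t B)^t* = A^t* *t B^t*.
Proof. by rewrite trmx_tens map_mxT. Qed.

Lemma fro_adj m n (A : 'M[C]_(m, n)) : fro (A^t*) = fro A.
Proof.
rewrite /fro exchange_big; apply: eq_bigr => i _; apply: eq_bigr => j _.
by rewrite !mxE normc_conj.
Qed.

Lemma mxtrace_adj_mul m n (A : 'M[C]_(m, n)) : \tr (A^t* *m A) = (fro A)%:C.
Proof.
rewrite /fro exchange_big rmorph_sum; apply: eq_bigr => j _.
rewrite mxE rmorph_sum; apply: eq_bigr => i _.
by rewrite !mxE conj_mul_normc.
Qed.

Lemma mulmx_entry_le m n p (A : 'M[C]_(m, n)) (B : 'M[C]_(n, p)) i k :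
  normc ((A *m B) i k) ^+ 2 <=
  (\sum_j normc (A i j) ^+ 2) * (\sum_j normc (B j k) ^+ 2).
Proof.
apply: le_trans (sum_mul_sqr_le xpredT _ _).
rewrite lerXn2r ?nnegrE ?normc_ge0 ?mxE //.
  by apply: sumr_ge0 => j _; rewrite mulr_ge0 ?normc_ge0.
apply: le_trans (normc_sum _ _) _.
by under eq_bigr do rewrite normcM.
Qed.

Lemma fro_mulmx m n p (A : 'M[C]_(m, n)) (B : 'M[C]_(n, p)) :
  fro (A *m B) <= fro A * fro B.
Proof.
rewrite /fro mulr_suml; apply: ler_sum => i _.
rewrite [X in _ * X]exchange_big mulr_sumr; apply: ler_sum => k _.
exact: mulmx_entry_le.
Qed.

(** Cauchy-Schwarz for the Hilbert-Schmidt inner product, over all pairs of indices. *)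
Lemma normc_mxtrace_mul m n (A : 'M[C]_(m, n)) (B : 'M[C]_(n, m)) :
  normc (\tr (A *m B)) ^+ 2 <= fro A * fro B.
Proof.
have fro_pair p q (X : 'M[C]_(p, q)) :
    fro X = \sum_(k : 'I_p * 'I_q) normc (X k.1 k.2) ^+ 2.
  by rewrite /fro pair_big.
rewrite -(fro_adj B) !fro_pair; apply: le_trans (sum_mul_sqr_le xpredT _ _).
rewrite lerXn2r ?nnegrE ?normc_ge0 //.
  by apply: sumr_ge0 => j _; rewrite mulr_ge0 ?normc_ge0.
have -> : \tr (A *m B) = \sum_(k : 'I_m * 'I_n) A k.1 k.2 * B k.2 k.1.
  by rewrite -(pair_bigA _ (fun i j => A i j * B j i)); apply: eq_bigr => i _; rewrite mxE.
apply: le_trans (normc_sum _ _) _; apply: ler_sum => k _.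
by rewrite normcM !mxE normc_conj.
Qed.

Lemma froD m n (A B : 'M[C]_(m, n)) :
  fro (A + B) = fro A + fro B + complex.Re (\tr (A^t* *m B)) *+ 2.
Proof.
apply: complexI.
rewrite -mxtrace_adj_mul adjD mulmxDl !mulmxDr !mxtraceD !mxtrace_adj_mul.
have -> : \tr (B^t* *m A) = Num.conj (\tr (A^t* *m B)).
  rewrite -[A in LHS](trmxCK A) -adjM.
  by rewrite (trace_map_mx (Num.conj : {rmorphism C -> C})) mxtrace_tr.
case: (\tr _) => a b /=; apply/eqP; rewrite eq_complex /=; apply/andP.
by split; apply/eqP; ring.
Qed.

(** Let a and b be the squared norms of AT and BT. Since a + b is the inner product of T with (A +
    B)T, (a + b)^2 <= ||(A + B)T||^2 = a + b + 2 Re <AT, BT> <= (a + b)(1 + c), and one divides by a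
    + b. The last hypothesis, |<AT, BT>| <= c ||AT|| ||BT||, stands in for the operator norm bound
    ||AB|| <= c. *)
Lemma projections_add_le m p (A B : 'M[C]_m) (T : 'M[C]_(m, p)) (c : R) :
  A^t* = A -> A *m A = A -> B^t* = B -> B *m B = B -> fro T = 1 -> 0 <= c ->
  normc (\tr ((A *m T)^t* *m (B *m T))) ^+ 2 <=
    c ^+ 2 * (fro (A *m T) * fro (B *m T)) ->
  fro (A *m T) + fro (B *m T) <= 1 + c.
Proof.
move=> Ah Ai Bh Bi T1 c0 hc.
set a := fro (A *m T) in hc *; set b := fro (B *m T) in hc *.
have a0 : 0 <= a := fro_ge0 _.
have b0 : 0 <= b := fro_ge0 _.
have expect (P : 'M[C]_m) : P^t* = P -> P *m P = P ->
    \tr (T^t* *m (P *m T)) = (fro (P *m T))%:C.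
  by move=> Ph Pi; rewrite -mxtrace_adj_mul adjM Ph -mulmxA (mulmxA P P) Pi.
have sq : (a + b) ^+ 2 <= fro (A *m T + B *m T).
  have := normc_mxtrace_mul (T^t*) (A *m T + B *m T).
  rewrite fro_adj T1 mul1r mulmxDr mxtraceD !expect // -rmorphD /=.
  by rewrite expr0n addr0 sqr_sqrtr ?sqr_ge0.
(* The hypothesis gives c sqrt(ab), and sqrt(ab) <= (a + b) / 2. *)
have cross : complex.Re (\tr ((A *m T)^t* *m (B *m T))) <= c * (a + b) / 2.
  apply: le_trans (Re_le_normc _) _.
  rewrite -(@ler_pXn2r _ 2) ?nnegrE ?normc_ge0 //; last first.
    by rewrite divr_ge0 ?mulr_ge0 ?addr_ge0.
  apply: le_trans hc _; rewrite -subr_ge0.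
  have -> : (c * (a + b) / 2) ^+ 2 - c ^+ 2 * (a * b) = (c * (a - b) / 2) ^+ 2.
    by field.
  exact: sqr_ge0.
rewrite froD -/a -/b in sq.
have [->|s_neq0] := eqVneq (a + b) 0; first by rewrite addr_ge0.
have s_gt0 : 0 < a + b by rewrite lt_def s_neq0 addr_ge0.
rewrite -(ler_pM2l s_gt0) -expr2; apply: le_trans sq _.
rewrite mulr2n; lra.
Qed.

End Frobenius.

(** * Two families of orthogonal projectors *)

Section Families.
Variable R : realType.
Local Notation C := R[i].

(** By the spectral theorem one takes the square roots of the eigenvalues. Such a factor [T] turns
    each probability tr(L^* L rho) into [fro (L *m T)]. *)
Lemma psd_mx_factor m (rho : 'M[C]_m) :
  psd_mx rho -> exists T : 'M[C]_m, rho = T *m T^t*.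
Proof.
move=> [rho_herm rho_ge0].
have rhoN : rho \is normalmx.
  by apply: hermitian_normalmx; apply/is_hermitianmxP; rewrite expr0 scale1r rho_herm.
have U : spectralmx rho \is unitarymx := spectral_unitarymx rho.
have := orthomx_spectralP rhoN; rewrite invmx_unitary //.
set P := spectralmx rho in U *; set D := spectral_diag rho => rhoE.
have PPh : P *m P^t* = 1%:M by apply/unitarymxP.
(* An eigenvalue is the value of the form at a unit eigenvector, here the adjoint of a row of
   [P]. *)
have D_ge0 i : 0 <= D 0 i.
  have := rho_ge0 ((row i P)^t*).
  have -> : ((row i P)^t*)^t* *m rho *m (row i P)^t* =
            row i P *m P^t* *m diag_mx D *m (row i P *m P^t*)^t*.
    by rewrite trmxCK rhoE adjM trmxCK !mulmxA.
  rewrite -row_mul PPh -mulmxA mxE (bigD1 i) //= big1 ?addr0.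
    rewrite !mxE (bigD1 i) //= big1 ?addr0; last first.
      by move=> j /negPf ji; rewrite !mxE eq_sym ji mul0r.
    by rewrite !mxE !eqxx conjC_nat mul1r mulr1.
  by move=> j /negPf ji; rewrite !mxE eq_sym ji mul0r.
exists (P^t* *m diag_mx (\row_i sqrtC (D 0 i))).
rewrite adjM trmxCK mulmxA -[X in X *m _]mulmxA rhoE.
congr (_ *m _ *m _).
rewrite tr_diag_mx map_diag_mx mulmx_diag; congr diag_mx.
apply/rowP=> i; rewrite !mxE /= geC0_conj ?sqrtC_ge0 //.
by rewrite -expr2 sqrtCK.
Qed.

Section Sum.
Variables (I : finType) (P : pred I) (r m : nat) (L : I -> 'M[C]_(r, m)).
(** The matrices [(L i)^t* *m L i] are mutually orthogonal projectors. Their factors [L i] may be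
    rectangular, which leaves room for bras. *)
Hypothesis orthoL : forall i j, P i -> P j ->
  ((L i)^t* *m L i) *m ((L j)^t* *m L j) = if i == j then (L i)^t* *m L i else 0.

Let A := \sum_(i | P i) (L i)^t* *m L i.

Lemma family_sum_herm : A^t* = A.
Proof.
by rewrite /A adj_sum; apply: eq_bigr => i _; rewrite adjM trmxCK.
Qed.

Lemma family_sum_idem : A *m A = A.
Proof.
rewrite {1 3}/A mulmx_suml; apply: eq_bigr => i Pi.
rewrite /A mulmx_sumr (bigD1 i) //= orthoL // eqxx big1 ?addr0 //.
by move=> j /andP[Pj /negPf ji]; rewrite orthoL // eq_sym ji.
Qed.

(** Pythagoras: as A is a self-adjoint idempotent, ||AT||^2 = tr(T^* A T), which is linear in A. *)
Lemma fro_family_sum p (T : 'M[C]_(m, p)) :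
  fro (A *m T) = \sum_(i | P i) fro (L i *m T).
Proof.
apply: complexI; rewrite -mxtrace_adj_mul adjM family_sum_herm.
rewrite mulmxA -(mulmxA _ A A) family_sum_idem /A mulmx_sumr mulmx_suml.
rewrite !raddf_sum; apply: eq_bigr => i _ /=.
by rewrite -mxtrace_adj_mul adjM !mulmxA.
Qed.

End Sum.

(** The sum of the squared Frobenius norms of the products L_i M_j^* controls the inner product of
    AT and BT, A and B being the sums of the two families. This yields the hypothesis of
    [projections_add_le]. *)
Lemma families_add_le (I J : finType) (P : pred I) (Q : pred J) r s m p
    (L : I -> 'M[C]_(r, m)) (M : J -> 'M[C]_(s, m)) (T : 'M[C]_(m, p)) (c : R) :
  (forall i j, P i -> P j -> ((L i)^t* *m L i) *m ((L j)^t* *m L j) =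
     if i == j then (L i)^t* *m L i else 0) ->
  (forall i j, Q i -> Q j -> ((M i)^t* *m M i) *m ((M j)^t* *m M j) =
     if i == j then (M i)^t* *m M i else 0) ->
  fro T = 1 -> 0 <= c ->
  \sum_(i | P i) \sum_(j | Q j) fro (L i *m (M j)^t*) <= c ^+ 2 ->
  \sum_(i | P i) fro (L i *m T) + \sum_(j | Q j) fro (M j *m T) <= 1 + c.
Proof.
move=> oL oM T1 c0 hc; rewrite -!fro_family_sum //.
apply: projections_add_le; rewrite ?family_sum_herm ?family_sum_idem //.
rewrite !fro_family_sum // adjM family_sum_herm.
set x := normc _.
(* By cyclicity the (i, j) term is the trace of L_i M_j^* times M_j T (L_i T)^*. Cauchy-Schwarz for
   the trace and submultiplicativity of the norm bound it. *)
have : x <= \sum_(k : I * J | P k.1 && Q k.2) Num.sqrt (fro (L k.1 *m (M k.2)^t*)) *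
    (Num.sqrt (fro (L k.1 *m T)) * Num.sqrt (fro (M k.2 *m T))).
  have -> : x = normc (\sum_(k : I * J | P k.1 && Q k.2)
       \tr ((L k.1 *m (M k.2)^t*) *m ((M k.2 *m T) *m (L k.1 *m T)^t*))).
    rewrite /x; congr normc; rewrite mulmx_sumr mulmx_suml mulmx_suml raddf_sum.
    rewrite -(pair_big P Q (fun i j =>
       \tr ((L i *m (M j)^t*) *m ((M j *m T) *m (L i *m T)^t*)))) /=.
    apply: eq_bigr => i _; rewrite mulmx_sumr raddf_sum; apply: eq_bigr => j _ /=.
    by rewrite [in RHS]mulmxA [RHS]mxtrace_mulC adjM !mulmxA.
  apply: le_trans (normc_sum _ _) _; apply: ler_sum => k _.
  rewrite -sqrtrM ?fro_ge0 // -sqrtrM ?fro_ge0 //.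
  rewrite -[leLHS](ger0_norm (normc_ge0 _)) -sqrtr_sqr ler_sqrt; last first.
    by do ?apply: mulr_ge0; exact: fro_ge0.
  apply: le_trans (normc_mxtrace_mul _ _) _; rewrite ler_wpM2l ?fro_ge0 //.
  by apply: le_trans (fro_mulmx _ _) _; rewrite fro_adj mulrC.
move=> xle; apply: (@le_trans _ _ ((\sum_(k : I * J | P k.1 && Q k.2)
    Num.sqrt (fro (L k.1 *m (M k.2)^t*)) *
    (Num.sqrt (fro (L k.1 *m T)) * Num.sqrt (fro (M k.2 *m T)))) ^+ 2)).
  rewrite lerXn2r ?nnegrE ?normc_ge0 //.
  by apply: sumr_ge0 => k _; do ?apply: mulr_ge0; exact: sqrtr_ge0.
(* A second Cauchy-Schwarz, now over the pairs (i, j). The second factor is a sum of products that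
   splits into the product of the two sums. *)
apply: le_trans (sum_mul_sqr_le _ _ _) _.
apply: ler_pM.
- by apply: sumr_ge0 => k _; exact: sqr_ge0.
- by apply: sumr_ge0 => k _; exact: sqr_ge0.
- apply: le_trans hc.
  rewrite (pair_big P Q (fun i j => fro (L i *m (M j)^t*))) /=.
  by apply: ler_sum => k _; rewrite sqr_sqrtr ?fro_ge0.
rewrite big_distrlr /= pair_big /=.
by apply: ler_sum => k _; rewrite exprMn !sqr_sqrtr ?fro_ge0.
Qed.

End Families.

(** * Qubits *)

Section Qubits.
Variable R : realType.
Local Notation C := R[i].

Lemma F2_bool (x : 'F_2) : x = (x != 0)%:R.
Proof. by case: x => [[|[|//]] ?]; apply: val_inj. Qed.

Lemma sum_F2 (V : nmodType) (f : 'F_2 -> V) : \sum_b f b = f 0 + f 1.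
Proof.
rewrite (bigD1 0) //=; congr (_ + _); rewrite (big_pred1 1) // => b.
by rewrite (F2_bool b); case: (b != 0).
Qed.

(** Distributivity; it reduces sums over n-bit strings to computations on one qubit. *)
Lemma sum_prod_bits (A : comPzSemiRingType) n (f : 'I_n -> 'F_2 -> A) :
  \sum_(u : bits n) \prod_i f i (u 0 i) = \prod_i \sum_b f i b.
Proof.
rewrite bigA_distr_bigA (reindex (fun phi : {ffun 'I_n -> 'F_2} => \row_i phi i)).
  by apply: eq_bigr => phi _; apply: eq_bigr => i _; rewrite mxE.
exists (fun u : bits n => [ffun i => u 0 i]) => [phi _|u _].
  by apply/ffunP=> i; rewrite ffunE mxE.
by apply/rowP=> i; rewrite mxE ffunE.
Qed.

Lemma sqrt2V_sqr : ((Num.sqrt 2)^-1%:C * (Num.sqrt 2)^-1%:C = 2^-1 :> C).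
Proof.
by rewrite -rmorphM /= -invfM -expr2 sqr_sqrtr ?ler0n // fmorphV rmorph_nat.
Qed.

Lemma qubit_ketE t (b k : 'F_2) : qubit_ket R t b k 0 =
  if t then (Num.sqrt 2)^-1%:C * (-1) ^+ ((b != 0) && (k != 0)) else (k == b)%:R.
Proof.
case: t; rewrite /qubit_ket !mxE ?eqxx ?andbT //.
by rewrite (F2_bool b) (F2_bool k); case: (b != 0); case: (k != 0);
  rewrite ?eqxx /= ?expr0 ?expr1 ?mulr1 ?mulr0 ?addr0 ?add0r ?mulr1.
Qed.

Lemma qubit_ket_conj t (b k : 'F_2) :
  Num.conj (qubit_ket R t b k 0) = qubit_ket R t b k 0.
Proof.
rewrite qubit_ketE; case: t; last by rewrite conjC_nat.
by rewrite rmorphM rmorphXn /= rmorphN1; congr (_ * _); exact: conjc_real.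
Qed.

(** The inner product of two kets; no conjugate appears because all amplitudes are real. *)
Definition qubit_overlap t (b : 'F_2) t' (b' : 'F_2) : C :=
  \sum_(k : 'F_2) qubit_ket R t b k 0 * qubit_ket R t' b' k 0.

Lemma qubit_overlap_same t b b' : qubit_overlap t b t b' = (b == b')%:R.
Proof.
rewrite /qubit_overlap sum_F2 !qubit_ketE (F2_bool b) (F2_bool b').
have := sqrt2V_sqr; set s := (_^-1)%:C => ss.
have two : 2^-1 + 2^-1 = 1 :> C by rewrite -div1r -splitr.
by case: t; case: (b != 0); case: (b' != 0);
  rewrite /= ?expr0 ?expr1 ?mulr1 ?mulrN1 ?mulNr ?mulrN ?opprK ?ss ?two ?subrr
    ?mul0r ?mulr0 ?add0r ?addr0.
Qed.

(** In equal bases the kets are orthonormal. In different bases the squared overlap is exactly 1/2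
    because the two bases are mutually unbiased, and 1/2 is below either value of the right-hand
    side. *)
Lemma normc_qubit_overlap t b t' b' :
  normc (qubit_overlap t b t' b') ^+ 2 <= (2^-1) ^+ (b != b').
Proof.
have [->|tt'] := eqVneq t t'.
  rewrite qubit_overlap_same; case: (b == b') => /=.
    by rewrite expr0n addr0 expr1n sqrtr1 expr1n.
  by rewrite expr0n addr0 sqrtr0 expr0n invr_ge0 ler0n.
suff -> : normc (qubit_overlap t b t' b') ^+ 2 = 2^-1 :> R.
  by case: (b != b'); rewrite ?expr1 ?expr0 // invf_le1 ?ler1n.
rewrite /qubit_overlap sum_F2 !qubit_ketE.
have s2 : normc ((Num.sqrt 2)^-1%:C : C) ^+ 2 = 2^-1.
  by rewrite /= expr0n /= addr0 sqrtr_sqr ger0_norm ?invr_ge0 ?sqrtr_ge0 //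
    exprVn sqr_sqrtr.
rewrite (F2_bool b) (F2_bool b').
have nN (z : C) : normc (- z) = normc z by case: z => x y /=; rewrite !sqrrN.
move: s2; set s := (_^-1)%:C => s2.
by move: tt'; case: t; case: t' => // _; case: (b != 0); case: (b' != 0);
  rewrite ?expr0 ?expr1 ?mulr1 ?mul1r ?mulrN1 ?mulNr ?mulrN ?opprK
    ?mul0r ?mulr0 ?oppr0 ?add0r ?addr0 ?nN ?s2.
Qed.

Lemma qubit_complete t (k l : 'F_2) :
  \sum_b qubit_ket R t b k 0 * qubit_ket R t b l 0 = (k == l)%:R.
Proof.
rewrite sum_F2 !qubit_ketE (F2_bool k) (F2_bool l).
have := sqrt2V_sqr; set s := (_^-1)%:C => ss.
have two : 2^-1 + 2^-1 = 1 :> C by rewrite -div1r -splitr.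
by case: t; case: (k != 0); case: (l != 0);
  rewrite /= ?expr0 ?expr1 ?mulr1 ?mulrN1 ?mulNr ?mulrN ?opprK ?ss ?two ?subrr
    ?mul0r ?mulr0 ?add0r ?addr0.
Qed.

Lemma qubits_overlap n (x x' : bits n) (th th' : bases n) :
  ((qubits_ket R x th)^t* *m qubits_ket R x' th') 0 0 =
  \prod_i qubit_overlap (th i) (x 0 i) (th' i) (x' 0 i).
Proof.
rewrite mxE /qubit_overlap -sum_prod_bits [RHS]big_enum_val /=.
apply: eq_bigr => k _; rewrite !mxE rmorph_prod -big_split /=.
by apply: eq_bigr => i _; rewrite qubit_ket_conj.
Qed.

Lemma qubits_overlap_same n (x x' : bits n) (th : bases n) :
  (qubits_ket R x th)^t* *m qubits_ket R x' th = (x == x')%:R%:M.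
Proof.
apply/matrixP=> i j; rewrite !ord1 qubits_overlap mxE eqxx mulr1n.
under eq_bigr do rewrite qubit_overlap_same.
have [->|xx'] := eqVneq x x'; first by rewrite big1 // => k _; rewrite eqxx.
have [k xk] : exists k, x 0 k != x' 0 k.
  apply/existsP; apply: contraNT xx'; rewrite negb_exists => /forallP h.
  by apply/eqP/rowP=> k; apply/eqP; have := h k; rewrite negbK.
by rewrite (bigD1 k) //= (negPf xk) mul0r.
Qed.

Lemma hamming_distE n (x y : bits n) :
  hamming_dist x y = (\sum_i (x 0%R i != y 0%R i))%N.
Proof.
by rewrite /hamming_dist -sum1dep_card big_mkcond; apply: eq_bigr => i _; case: ifP.
Qed.

(** The overlap factors over the positions, and each position where the strings differ costs at
    least a factor 2, whatever the bases. *)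
Lemma normc_qubits_overlap n (x x' : bits n) (th th' : bases n) :
  normc (((qubits_ket R x th)^t* *m qubits_ket R x' th') 0 0) ^+ 2 <=
  (2^-1) ^+ hamming_dist x x'.
Proof.
rewrite qubits_overlap.
have -> : normc (\prod_i qubit_overlap (th i) (x 0 i) (th' i) (x' 0 i)) ^+ 2 =
    \prod_i normc (qubit_overlap (th i) (x 0 i) (th' i) (x' 0 i)) ^+ 2.
  rewrite prodrXl; congr (_ ^+ 2).
  by apply: (big_morph _ (@normcM R) (@normc1 R)).
rewrite hamming_distE expr_sum; apply: ler_prod => i _.
by rewrite sqr_ge0 normc_qubit_overlap.
Qed.

(** Product weights make the entries factor over the qubits. It serves with constant weights, with
    the indicator of Bob's acceptance, and with the weights 2^-dist. *)
Lemma weighted_ketbra n (c : 'I_n -> 'F_2 -> C) (th : bases n) k l :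
  (\sum_(u : bits n) (\prod_i c i (u 0 i)) *:
     (qubits_ket R u th *m (qubits_ket R u th)^t*)) k l =
  \prod_i \sum_b c i b * (qubit_ket R (th i) b ((enum_val k : bits n) 0 i) 0 *
     qubit_ket R (th i) b ((enum_val l : bits n) 0 i) 0).
Proof.
rewrite summxE -sum_prod_bits; apply: eq_bigr => u _.
rewrite !mxE big_ord1 !mxE rmorph_prod -!big_split /=.
by apply: eq_bigr => i _; rewrite qubit_ket_conj.
Qed.

Lemma qubits_complete n (th : bases n) :
  \sum_(u : bits n) qubits_ket R u th *m (qubits_ket R u th)^t* = 1%:M.
Proof.
have -> : \sum_(u : bits n) qubits_ket R u th *m (qubits_ket R u th)^t* =
    \sum_(u : bits n) (\prod_(i < n) 1) *: (qubits_ket R u th *m (qubits_ket R u th)^t*).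
  by apply: eq_bigr => u _; rewrite big1 // scale1r.
apply/matrixP=> k l; rewrite mxE (weighted_ketbra (fun _ _ => 1)).
under eq_bigr => i _.
  under eq_bigr do rewrite mul1r.
  rewrite qubit_complete; over.
have [->|kl] := eqVneq k l; first by rewrite big1 // => i _; rewrite eqxx.
have [i hi] : exists i, (enum_val k : bits n) 0 i != (enum_val l : bits n) 0 i.
  apply/existsP; apply: contraNT kl; rewrite negb_exists => /forallP h.
  by apply/eqP/enum_val_inj/rowP=> i; apply/eqP; have := h i; rewrite negbK.
by rewrite (bigD1 i) //= (negPf hi) mul0r.
Qed.



(** Half of the time Bob measures in the announced basis and must find x; otherwise he accepts any
    outcome. The average (|x><x| + 1) / 2 has eigenvalue 1 at |x> and 1/2 at the other ket of that
    basis. *)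
Lemma qubit_povm t (x k l : 'F_2) :
  2^-1 * (\sum_t' \sum_b ((t' == t) ==> (b == x))%:R *
     (qubit_ket R t' b k 0 * qubit_ket R t' b l 0)) =
  \sum_b (2^-1) ^+ (b != x) * (qubit_ket R t b k 0 * qubit_ket R t b l 0) :> C.
Proof.
(* By completeness, weight 1 at x and c elsewhere is 1 - c on |x><x| plus c times the identity. The
   values used are c = 1/2 and c = 0. *)
have x_term (c : C) : \sum_b (if b == x then 1 else c) *
    (qubit_ket R t b k 0 * qubit_ket R t b l 0) =
    (1 - c) * (qubit_ket R t x k 0 * qubit_ket R t x l 0) + c * (k == l)%:R.
  rewrite -(qubit_complete t k l) mulr_sumr (bigD1 x) //= eqxx.
  rewrite [in RHS](bigD1 x) //= [RHS]addrA -mulrDl subrK; congr (_ + _).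
  by apply: eq_bigr => b /negPf ->.
have -> : \sum_b (2^-1) ^+ (b != x) * (qubit_ket R t b k 0 * qubit_ket R t b l 0) =
    2^-1 * (qubit_ket R t x k 0 * qubit_ket R t x l 0 + (k == l)%:R) :> C.
  have := x_term 2^-1; under eq_bigr => b _.
    have -> : (if b == x then 1 else 2^-1) = (2^-1) ^+ (b != x) :> C.
      by case: (b == x).
    over.
  by move->; rewrite mulrDr {1}(splitr 1) div1r addrK.
congr (_ * _); rewrite (bigD1 t) //=; congr (_ + _).
  have := x_term 0; rewrite subr0 mul1r mul0r addr0 => <-.
  by apply: eq_bigr => b _; rewrite eqxx /=; case: (b == x).
(* The other basis imposes no condition, so its kets sum to the identity. *)
rewrite (big_pred1 (~~ t)); last by clear; case: t => -[].
rewrite -(qubit_complete (~~ t)); apply: eq_bigr => b _.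
by clear; case: t; rewrite /= mul1r.
Qed.

(** Bob's choice of basis and his test are independent across positions, so both sides factor and
    [qubit_povm] compares the factors. *)
Lemma bob_povmE n r (H : 'M['F_2]_(r, n)) (I : finType)
    (g : I -> bits n -> 'F_2) w j s b y : y \in openings H g w j s b ->
  bob_povm R H g w j s b y =
  \sum_(u : bits n) (2^-1) ^+ hamming_dist u y.1 *:
     (qubits_ket R u y.2 *m (qubits_ket R u y.2)^t*).
Proof.
move=> y_op; apply/matrixP=> k l; rewrite mxE summxE.
have -> : \sum_(u : bits n) (2^-1) ^+ hamming_dist u y.1 *:
     (qubits_ket R u y.2 *m (qubits_ket R u y.2)^t*) =
    \sum_(u : bits n) (\prod_i (2^-1) ^+ (u 0 i != y.1 0 i)) *:
     (qubits_ket R u y.2 *m (qubits_ket R u y.2)^t*).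
  by apply: eq_bigr => u _; rewrite hamming_distE expr_sum.
rewrite (weighted_ketbra (fun i b => (2^-1) ^+ (b != y.1 0 i))).
under [X in _ * X = _]eq_bigr => th _.
  have -> : \sum_(u | bob_accepts H g w j s b y th u)
       qubits_ket R u th *m (qubits_ket R u th)^t* =
     \sum_(u : bits n) (\prod_i ((th i == y.2 i) ==> (u 0 i == y.1 0 i))%:R) *:
       (qubits_ket R u th *m (qubits_ket R u th)^t*).
    rewrite big_mkcond; apply: eq_bigr => u _; rewrite /bob_accepts y_op /=.
    case: forallP => [acc|/forallP/forallPn[i /negPf nacc]].
      by rewrite big1 ?scale1r // => i _; rewrite acc.
    by rewrite (bigD1 i) //= nacc mul0r scale0r.
  rewrite (weighted_ketbra (fun i b => ((th i == y.2 i) ==> (b == y.1 0 i))%:R)).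
  over.
(* The sum over all basis strings of a product becomes a product of sums over one basis; 2^-n is
   then spread over the n factors. *)
rewrite -(bigA_distr_bigA (fun i t => \sum_b ((t == y.2 i) ==> (b == y.1 0 i))%:R *
  (qubit_ket R t b ((enum_val k : bits n) 0 i) 0 *
   qubit_ket R t b ((enum_val l : bits n) 0 i) 0))).
have -> : (2 ^+ n)^-1 = \prod_(i < n) 2^-1 :> C.
  by rewrite prodr_const card_ord exprVn.
by rewrite -big_split; apply: eq_bigr => i _; exact: qubit_povm.
Qed.

End Qubits.

(** * Entropy bound for Hamming balls *)

Section Entropy.
Variable R : realType.

Lemma ln2_gt0 : 0 < ln (2 : R).
Proof. by rewrite ln_gt0 // ltr1n. Qed.

Lemma powR2E (x : R) : 2 `^ x = expR (x * ln 2).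
Proof. by rewrite /powR pnatr_eq0. Qed.

Lemma binary_entropy_ln2 (t : R) :
  binary_entropy t * ln 2 = - (t * ln t + (1 - t) * ln (1 - t)).
Proof.
by rewrite /binary_entropy /log2; field; rewrite gt_eqF ?ln2_gt0.
Qed.

Lemma binary_entropy_ge0 (t : R) : 0 < t <= 1 -> 0 <= binary_entropy t.
Proof.
move=> /andP[t0 t1]; rewrite -(pmulr_lge0 _ ln2_gt0) binary_entropy_ln2 oppr_ge0.
have h1 : t * ln t <= 0 by rewrite mulr_ge0_le0 ?ln_le0 // ltW.
have h2 : (1 - t) * ln (1 - t) <= 0 by rewrite mulr_ge0_le0 ?ln_le0 //; lra.
lra.
Qed.

(** The radius is real, so that [t * n%:R] needs no rounding. *)
Definition hamming_ball n (x : bits n) (t : R) : {set bits n} :=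
  [set u | (hamming_dist u x)%:R <= t].

(** Flip each bit of x independently with probability t. The resulting probabilities sum to 1, and
    as t <= 1/2 each point of the ball has probability at least 2^(- h(t) n). *)
Lemma card_hamming_ball n (x : bits n) (t : R) : 0 < t <= 1 / 2 ->
  #|hamming_ball x (t * n%:R)|%:R <= 2 `^ (binary_entropy t * n%:R).
Proof.
move=> /andP[t0 t12].
have t1 : 0 < 1 - t by lra.
have total : \sum_(u : bits n) \prod_i (if u 0 i != x 0 i then t else 1 - t) = 1.
  rewrite (sum_prod_bits (fun i b => if b != x 0 i then t else 1 - t)) big1 // => i _.
  by rewrite sum_F2 (F2_bool (x 0 i)); case: (x 0 i != 0) => /=; rewrite ?subrK ?subrKC.
have weight (u : bits n) :
    \prod_i (if u 0 i != x 0 i then t else 1 - t) =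
    expR (n%:R * ln (1 - t) + (hamming_dist u x)%:R * (ln t - ln (1 - t))).
  have -> : n%:R * ln (1 - t) + (hamming_dist u x)%:R * (ln t - ln (1 - t)) =
      \sum_(i < n) (ln (1 - t) + (u 0 i != x 0 i)%:R * (ln t - ln (1 - t))).
    rewrite big_split /= sumr_const card_ord -[ln _ *+ n]mulr_natl; congr (_ + _).
    by rewrite hamming_distE natr_sum mulr_suml.
  rewrite expR_sum; apply: eq_bigr => i _; case: (_ != _).
    by rewrite mul1r subrKC lnK.
  by rewrite mul0r addr0 lnK.
have lnle : ln t <= ln (1 - t) by rewrite ler_ln ?posrE //; lra.
rewrite -sum1_card natr_sum big_mkcond -[leRHS]mulr1 -[X in _ <= _ * X]total mulr_sumr.
apply: ler_sum => u _; rewrite weight powR2E -expRD mulrAC binary_entropy_ln2.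
case: ifP => [|_]; last exact: expR_ge0.
rewrite inE => u_ball; rewrite -[X in X <= _]expR0 ler_expR.
(* This product is exactly the exponent that has to be nonnegative. *)
have : 0 <= (t * n%:R - (hamming_dist u x)%:R) * (ln (1 - t) - ln t).
  by rewrite mulr_ge0 // subr_ge0.
rewrite !mulrBl !mulrBr; lra.
Qed.

End Entropy.

(** * Measurements on a tensor product *)

Section Tensors.
Variable R : realType.
Local Notation C := R[i].

Lemma mxtrace_tens m n (A : 'M[C]_m) (B : 'M[C]_n) : \tr (A *t B) = \tr A * \tr B.
Proof. by rewrite /mxtrace mulr_sum; apply: eq_bigr => i _; rewrite mxE. Qed.

Lemma fro_tens m n p q (A : 'M[C]_(m, n)) (B : 'M[C]_(p, q)) :
  fro (A *t B) = fro A * fro B.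
Proof.
apply: complexI; rewrite rmorphM /= -!mxtrace_adj_mul adj_tens tensmx_mul.
exact: mxtrace_tens.
Qed.

Lemma tensmx_sumr m n p q (I : finType) (P : pred I) (A : 'M[C]_(m, n))
    (B : I -> 'M[C]_(p, q)) :
  A *t (\sum_(i | P i) B i) = \sum_(i | P i) A *t B i.
Proof.
apply/matrixP=> k l; rewrite mxE !summxE mulr_sumr.
by apply: eq_bigr => i _; rewrite mxE.
Qed.

Lemma tensmx_suml m n p q (I : finType) (P : pred I) (A : I -> 'M[C]_(m, n))
    (B : 'M[C]_(p, q)) :
  (\sum_(i | P i) A i) *t B = \sum_(i | P i) A i *t B.
Proof.
apply/matrixP=> k l; rewrite mxE !summxE mulr_suml.
by apply: eq_bigr => i _; rewrite mxE.
Qed.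

Lemma tensmxZr m n p q (c : C) (A : 'M[C]_(m, n)) (B : 'M[C]_(p, q)) :
  A *t (c *: B) = c *: (A *t B).
Proof. by apply/matrixP=> k l; rewrite !mxE mulrCA. Qed.

Lemma tensmx1 m n : 1%:M *t 1%:M = 1%:M :> 'M[C]_(m * n).
Proof.
apply/matrixP=> k l; case: (mxtens_indexP k) => i j; case: (mxtens_indexP l) => i' j'.
rewrite tensmxE !mxE (can_eq (@mxtens_indexK m n)) -natrM mulnb.
by rewrite xpair_eqE.
Qed.

End Tensors.

(** * Joint outcomes of the committer and the receiver *)

Section Adversary.
Variables (R : realType) (n : nat).
Local Notation C := R[i].
Local Notation pos := (bits n * bases n)%type.

(** For k = ((x, theta), u) this is F_(x,theta) tensored with the bra of u in basis theta: the
    committer opens (x, theta) and a measurement of B in the announced basis gives u. The bra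
    accounts for the row dimension [a * 1]. *)
Definition reveal a (F : pos -> 'M[C]_a) (k : pos * bits n) :
    'M[C]_(a * 1, a * #|{: bits n}|) :=
  F k.1 *t (qubits_ket R k.2 k.1.2)^t*.

Section Measurement.
Variables (Y : {set pos}) (a : nat) (F : pos -> 'M[C]_a).
Hypothesis measF : projective_measurement Y F.

Lemma reveal_adj_mul k : k.1 \in Y -> (reveal F k)^t* *m reveal F k =
  F k.1 *t (qubits_ket R k.2 k.1.2 *m (qubits_ket R k.2 k.1.2)^t*).
Proof.
case: measF => FP _ _ /FP[Fh Fi].
by rewrite /reveal adj_tens trmxCK tensmx_mul Fh Fi.
Qed.

(** Different openings are separated by F, whatever their bases; for the same opening the kets
    belong to one orthonormal basis. *)
Lemma reveal_ortho k l : k.1 \in Y -> l.1 \in Y ->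
  ((reveal F k)^t* *m reveal F k) *m ((reveal F l)^t* *m reveal F l) =
  if k == l then (reveal F k)^t* *m reveal F k else 0.
Proof.
case: k l => [y u] [z v] /= yY zY; rewrite !reveal_adj_mul //= tensmx_mul.
case: measF => FP F0 _.
rewrite xpair_eqE; have [<-|yz] /= := eqVneq y z; last by rewrite F0 // tens0mx.
have [_ ->] := FP y yY.
rewrite -mulmxA (mulmxA _ (qubits_ket R v y.2)) qubits_overlap_same.
case: eqVneq => [<-|_]; first by rewrite mul1mx.
by rewrite raddf0 mul0mx mulmx0 tensmx0.
Qed.

Lemma sum_reveal : \sum_(y in Y) \sum_u (reveal F (y, u))^t* *m reveal F (y, u) = 1%:M.
Proof.
case: (measF) => _ _ F1; rewrite -tensmx1 -F1 tensmx_suml.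
apply: eq_bigr => y yY; rewrite -(qubits_complete R y.2) tensmx_sumr.
by apply: eq_bigr => u _; rewrite reveal_adj_mul.
Qed.

Lemma sum_fro_reveal m (T : 'M[C]_(_, m)) :
  \sum_(y in Y) \sum_u fro (reveal F (y, u) *m T) = fro T.
Proof.
apply: complexI; rewrite -mxtrace_adj_mul -[X in _ = \tr (_ *m X)]mul1mx -sum_reveal.
rewrite mulmx_suml mulmx_sumr !raddf_sum; apply: eq_bigr => y _ /=.
rewrite mulmx_suml mulmx_sumr !raddf_sum; apply: eq_bigr => u _ /=.
by rewrite -mxtrace_adj_mul adjM !mulmxA.
Qed.

End Measurement.

(** ||F_y G_z||^2 = tr(G_z F_y G_z); summing over y and then over z leaves the trace of the
    identity. This is where the size of the quantum memory enters. *)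
Lemma sum_fro_mul (Y Z : {set pos}) a (F G : pos -> 'M[C]_a) :
  projective_measurement Y F -> projective_measurement Z G ->
  \sum_(y in Y) \sum_(z in Z) fro (F y *m G z) = a%:R.
Proof.
move=> [FP _ F1] [GP _ G1]; rewrite exchange_big /=.
apply: complexI; rewrite rmorph_sum rmorph_nat -mxtrace1 -G1 raddf_sum.
apply: eq_bigr => z zZ; rewrite rmorph_sum; have [Gh Gi] := GP z zZ.
under eq_bigr => y yY.
  have [Fh Fi] := FP y yY.
  rewrite /= -mxtrace_adj_mul adjM Fh Gh -mulmxA (mulmxA (F y)) Fi mulmxA.
  over.
by rewrite -raddf_sum -mulmx_suml -mulmx_sumr F1 mulmx1 Gi.
Qed.

Lemma fro_reveal_mul a (F G : pos -> 'M[C]_a) k l :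
  fro (reveal F k *m (reveal G l)^t*) <=
  (2^-1) ^+ hamming_dist k.2 l.2 * fro (F k.1 *m (G l.1)^t*).
Proof.
rewrite /reveal adj_tens trmxCK tensmx_mul fro_tens mulrC.
rewrite ler_wpM2r ?fro_ge0 // /fro !big_ord1.
exact: normc_qubits_overlap.
Qed.

End Adversary.

(** * Hamming distance *)

Lemma hamming_triangle n (x y z : bits n) :
  (hamming_dist x z <= hamming_dist x y + hamming_dist y z)%N.
Proof.
rewrite !hamming_distE -big_split; apply: leq_sum => i _ /=.
by have [->|] := eqVneq (x 0 i) (y 0 i); rewrite ?leq_addl // => _; case: eqP.
Qed.

Lemma hamming_distC n (x y : bits n) : hamming_dist x y = hamming_dist y x.
Proof. by rewrite !hamming_distE; apply: eq_bigr => i _; rewrite eq_sym. Qed.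

Lemma hamming_dist_sub n (x y : bits n) : hamming_dist x y = hamming_dist (x - y) 0.
Proof.
by rewrite !hamming_distE; apply: eq_bigr => i _; rewrite !mxE subr_eq0.
Qed.

Lemma hamming_dist_le n (x y : bits n) : (hamming_dist x y <= n)%N.
Proof. by rewrite -[leqRHS]card_ord max_card. Qed.

Lemma half_exp_le1 (R : realFieldType) k : (2^-1 : R) ^+ k <= 1.
Proof. by apply: exprn_ile1; lra. Qed.

(** * Distance between openings and success probability *)

Section Scheme.
Variables (R : realType) (n r : nat) (H : 'M['F_2]_(r, n)).
Variables (I : finType) (g : I -> bits n -> 'F_2).
Local Notation C := R[i].

(** Equal syndromes put the difference of the two strings in the code, and different hash values
    make it nonzero. *)
Lemma openings_dist (D : {vspace bits n}) d w j s y z :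
  parity_check D H -> min_distance D d ->
  y \in openings H g w j s 0 -> z \in openings H g w j s 1 ->
  (d <= hamming_dist y.1 z.1)%N.
Proof.
move=> parity [_ dmin]; rewrite !inE => /andP[/eqP sy /eqP gy] /andP[/eqP sz /eqP gz].
rewrite hamming_dist_sub; apply: dmin; last 1 first.
- rewrite subr_eq0; apply/eqP=> yz; move: gy; rewrite yz gz => /eqP.
  by rewrite oner_eq0.
- rewrite parity; move: sy sz; rewrite /syndrome => sy sz.
  by rewrite linearB /= mulmxBr sy sz subrr.
by rewrite mem0v.
Qed.

Section Success.
Variables (w : 'F_2) (j : I) (s : 'cV['F_2]_r) (b : 'F_2) (a : nat).
Variables (F : bits n * bases n -> 'M[C]_a).
Variables (m : nat) (T : 'M[C]_(a * #|{: bits n}|, m)).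
Hypothesis measF : projective_measurement (openings H g w j s b) F.

(** Bob's POVM element is diagonal in the announced basis, with eigenvalue 2^-dist(u, x) at u, and
    the [fro] factor is the probability of the joint outcome (y, u). *)
Lemma successE : success H g (T *m T^t*) w j s b F =
  \sum_(y in openings H g w j s b) \sum_u
    2^-1 ^+ hamming_dist u y.1 * fro (reveal F (y, u) *m T).
Proof.
apply: complexI; rewrite /success rmorph_sum /=.
suff -> : \sum_(y in openings H g w j s b)
      \tr (F y *t bob_povm R H g w j s b y *m (T *m T^t*)) =
    (\sum_(y in openings H g w j s b) \sum_u
      2^-1 ^+ hamming_dist u y.1 * fro (reveal F (y, u) *m T))%:C :> C.
  by rewrite rmorph_sum.
rewrite rmorph_sum; apply: eq_bigr => y yY.
rewrite bob_povmE // tensmx_sumr mulmx_suml !raddf_sum; apply: eq_bigr => u _ /=.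
rewrite tensmxZr -(reveal_adj_mul (k := (y, u)) measF) // -scalemxAl mxtraceZ.
rewrite rmorphM rmorphXn /= fmorphV rmorph_nat -mxtrace_adj_mul adjM; congr (_ * _).
by rewrite mulmxA mxtrace_mulC !mulmxA.
Qed.

Hypothesis T1 : fro T = 1.

Lemma success_le1 : success H g (T *m T^t*) w j s b F <= 1.
Proof.
rewrite successE -[leRHS]T1 -(sum_fro_reveal measF); apply: ler_sum => y _.
apply: ler_sum => u _; rewrite ler_piMl ?fro_ge0 //.
exact: half_exp_le1.
Qed.

(** Weights in the ball are at most 1; those outside are at most 2^-t and act on a total mass of
    1. *)
Lemma success_le_ball (t : R) : success H g (T *m T^t*) w j s b F <=
  \sum_(k | (k.1 \in openings H g w j s b) && (k.2 \in hamming_ball k.1.1 t))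
    fro (reveal F k *m T) + 2 `^ (- t).
Proof.
(* The tail is written as 2^-t times the total mass, to compare the sums term by term. *)
rewrite -[X in _ + X]mulr1 -[X in _ + _ * X]T1 -(sum_fro_reveal measF) mulr_sumr successE.
rewrite -(pair_big_dep (mem (openings H g w j s b))
  (fun y u => u \in hamming_ball y.1 t) (fun y u => fro (reveal F (y, u) *m T))).
rewrite -big_split; apply: ler_sum => y _ /=.
rewrite [X in _ <= X + _]big_mkcond mulr_sumr -big_split; apply: ler_sum => u _ /=.
have p0 := fro_ge0 (reveal F (y, u) *m T).
case: ifPn => [_|]; last rewrite inE => far.
  apply: (@le_trans _ _ (fro (reveal F (y, u) *m T))).
    by rewrite ler_piMl ?half_exp_le1.
  by rewrite lerDl mulr_ge0 ?powR_ge0.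
rewrite add0r ler_wpM2r // exprVn -powR_mulrn ?ler0n // -powRN ler_powR ?ler1n //.
by rewrite lerN2 ltW // ltNge.
Qed.

End Success.
End Scheme.

(** The default value of [sup] is 0, taken here when a set is empty; [1 <= c] covers that case. *)
Lemma sup_add_le (R : realType) (A B : set R) (c : R) : 1 <= c ->
  (forall x, A x -> x <= 1) -> (forall y, B y -> y <= 1) ->
  (forall x y, A x -> B y -> x + y <= c) -> sup A + sup B <= c.
Proof.
move=> c1 A1 B1 AB.
have sup1 (E : set R) : (forall x, E x -> x <= 1) -> sup E <= 1.
  move=> E1; have [E0|/sup_out ->] := pselect (has_sup E); last exact: ler01.
  by apply: ge_sup; [case: E0 | move=> x /E1].
have [[A0 _]|/sup_out ->] := pselect (has_sup A); last first.
  by rewrite add0r (le_trans (sup1 _ B1)).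
have [[B0 _]|/sup_out ->] := pselect (has_sup B); last first.
  by rewrite addr0 (le_trans (sup1 _ A1)).
rewrite -lerBrDr; apply: ge_sup => // x Ax.
rewrite lerBrDr addrC -lerBrDr; apply: ge_sup => // y By.
by rewrite lerBrDr addrC AB.
Qed.

(** * The binding bound *)

Section Binding.
Variables (R : realType) (n r : nat) (H : 'M['F_2]_(r, n)).
Variables (I : finType) (g : I -> bits n -> 'F_2).
Local Notation C := R[i].

(** By the triangle inequality points of two balls are at distance at least d - 2t, which bounds
    their squared overlap by 2^(2t - d). Each pair of openings occurs for at most V^2 pairs of
    points, and [sum_fro_mul] sums the remaining factors to the dimension of A. *)
Lemma sum_fro_reveal_mul_le (D : {vspace bits n}) d w j s a
    (F G : bits n * bases n -> 'M[C]_a) (t V : R) :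
  parity_check D H -> min_distance D d ->
  projective_measurement (openings H g w j s 0) F ->
  projective_measurement (openings H g w j s 1) G ->
  (forall x : bits n, #|hamming_ball x t|%:R <= V) ->
  \sum_(k | (k.1 \in openings H g w j s 0) && (k.2 \in hamming_ball k.1.1 t))
    \sum_(l | (l.1 \in openings H g w j s 1) && (l.2 \in hamming_ball l.1.1 t))
      fro (reveal F k *m (reveal G l)^t*) <=
  2 `^ (2 * t - d%:R) * V ^+ 2 * a%:R.
Proof.
move=> parity dmin measF measG ballV.
have V0 : 0 <= V := le_trans (ler0n _ _) (ballV 0).
pose f y z := 2 `^ (2 * t - d%:R) * fro (F y *m G z).
have f0 y z : 0 <= f y z by rewrite mulr_ge0 ?powR_ge0 ?fro_ge0.
have term k l : (k.1 \in openings H g w j s 0) && (k.2 \in hamming_ball k.1.1 t) ->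
    (l.1 \in openings H g w j s 1) && (l.2 \in hamming_ball l.1.1 t) ->
    fro (reveal F k *m (reveal G l)^t*) <= f k.1 l.1.
  move=> /andP[ky]; rewrite inE => ku /andP[lz]; rewrite inE => lv.
  apply: le_trans (fro_reveal_mul _ _ _ _) _.
  case: (measG) => GP _ _; have [-> _] := GP _ lz.
  rewrite ler_wpM2r ?fro_ge0 // exprVn -powR_mulrn ?ler0n // -powRN ler_powR ?ler1n //.
  have : (d <= hamming_dist k.2 k.1.1 + hamming_dist k.2 l.2 + hamming_dist l.2 l.1.1)%N.
    apply: leq_trans (openings_dist parity dmin ky lz) _.
    apply: leq_trans (hamming_triangle _ l.2 _) _; rewrite leq_add2r.
    by rewrite (hamming_distC k.2 k.1.1) hamming_triangle.
  rewrite -(ler_nat R) !natrD; lra.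
apply: (@le_trans _ _ (\sum_(y in openings H g w j s 0) \sum_(z in openings H g w j s 1)
    f y z * V ^+ 2)); last first.
  have -> : \sum_(y in openings H g w j s 0) \sum_(z in openings H g w j s 1)
      f y z * V ^+ 2 = 2 `^ (2 * t - d%:R) * V ^+ 2 * a%:R.
    rewrite -(sum_fro_mul measF measG) mulr_sumr; apply: eq_bigr => y _.
    by rewrite mulr_sumr; apply: eq_bigr => z _; rewrite /f mulrAC.
  exact: lexx.
apply: le_trans (ler_sum _ (fun k kP => ler_sum _ (fun l lP => term k l kP lP))) _.
(* The bound no longer depends on the points of the balls, so the sums over them become
   cardinalities. *)
rewrite -(pair_big_dep (mem (openings H g w j s 0)) (fun y u => u \in hamming_ball y.1 t)
  (fun y u => \sum_(l | (l.1 \in openings H g w j s 1) &&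
                        (l.2 \in hamming_ball l.1.1 t)) f y l.1)).
apply: ler_sum => y _; rewrite sumr_const -mulr_natr.
rewrite -(pair_big_dep (mem (openings H g w j s 1)) (fun z v => v \in hamming_ball z.1 t)
  (fun z v => f y z)) mulr_suml.
apply: ler_sum => z _; rewrite sumr_const -[f y z *+ _]mulr_natr -mulrA expr2.
by rewrite ler_wpM2l ?f0 // ler_pM ?ler0n.
Qed.

Lemma success_add_le (D : {vspace bits n}) d w j s a m
    (T : 'M[C]_(a * #|{: bits n}|, m)) (F G : bits n * bases n -> 'M[C]_a) (q t : R) :
  parity_check D H -> min_distance D d -> 0 < t <= 1 ->
  a%:R <= 2 `^ q -> fro T = 1 ->
  projective_measurement (openings H g w j s 0) F ->
  projective_measurement (openings H g w j s 1) G ->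
  success H g (T *m T^t*) w j s 0 F + success H g (T *m T^t*) w j s 1 G <=
  1 + (2 `^ (1 / 2 * (q - d%:R / 2 + t * n%:R + binary_entropy t * n%:R))
       + 2 * 2 `^ (- t * n%:R)).
Proof.
move=> parity dmin t01 aq T1 measF measG.
set E := q - _ + _ + _; set c := 2 `^ (1 / 2 * E).
have [t0 t1] := andP t01.
have h0 : 0 <= binary_entropy t * n%:R by rewrite mulr_ge0 ?ler0n ?binary_entropy_ge0.
have a1 : (0 < a)%N.
  rewrite lt0n; apply: contraPneq T1 => a0.
  suff -> : fro T = 0 by move/esym/eqP; rewrite oner_eq0.
  have empty : (a * #|{: bits n}| <= 0)%N by rewrite a0.
  by rewrite /fro big1 // => i; have := leq_trans (ltn_ord i) empty.
have tail0 : 0 <= 2 `^ (- t * n%:R) :> R by exact: powR_ge0.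
have c0 : 0 <= c by exact: powR_ge0.
(* [E - q] is the exponent e = h n + t n - d/2. If e >= 0 then c >= 1 and the bound is at least 2,
   the trivial bound on two probabilities. *)
have [E_big|E_small] := leP 0 (E - q).
  have c1 : 1 <= c.
    rewrite -[leLHS](powRr0 2) ler_powR ?ler1n //.
    suff : 0 <= q by lra.
    rewrite leNgt; apply/negP => q0.
    have : 2 `^ q < 1 :> R.
      by rewrite powR2E expR_lt1 pmulr_llt0 ?ln2_gt0.
    by rewrite ltNge (le_trans _ aq) // ler1n.
  apply: le_trans (lerD (success_le1 measF T1) (success_le1 measG T1)) _.
  by rewrite lerD2l (le_trans c1) // lerDl mulr_ge0.
(* From e < 0 one gets t n < d/2 <= n/2; the entropy bound on the balls requires t <= 1/2. *)
have t_half : t <= 1 / 2.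
  have dn : d%:R <= n%:R :> R.
    have [[u [v [_ _ _ <-]]] _] := dmin.
    by rewrite ler_nat hamming_dist_le.
  have n0 : 0 < n%:R :> R.
    rewrite ltr0n lt0n; apply: contraTneq E_small => n0.
    move: dn h0; rewrite /E n0 !mulr0; have := ler0n R d; lra.
  rewrite -(ler_pM2r n0); rewrite /E in E_small; lra.
have ballV (x : bits n) : #|hamming_ball x (t * n%:R)|%:R <= 2 `^ (binary_entropy t * n%:R).
  by apply: card_hamming_ball; rewrite t0.
(* The exponent on the left is at most q + 2e, and that on the right is E = q + e; e < 0
   concludes. *)
have cross : 2 `^ (2 * (t * n%:R) - d%:R) * (2 `^ (binary_entropy t * n%:R)) ^+ 2 * a%:R
    <= c ^+ 2.
  apply: (@le_trans _ _ (2 `^ (2 * (t * n%:R) - d%:R) *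
      (2 `^ (binary_entropy t * n%:R)) ^+ 2 * 2 `^ q)).
    by rewrite ler_wpM2l // mulr_ge0 ?sqr_ge0 ?powR_ge0.
  have two0 : (2 : R) != 0 by rewrite pnatr_eq0.
  rewrite !expr2 -!powRD ?two0 ?implybT // ler_powR ?ler1n //.
  move: E_small; rewrite /E; lra.
apply: le_trans (lerD (success_le_ball measF T1 (t * n%:R))
  (success_le_ball measG T1 (t * n%:R))) _.
rewrite addrACA mulNr [2 * _]mulr_natl [_ `^ _ *+ 2]mulr2n [leRHS]addrA lerD2r.
apply: families_add_le => //.
- by move=> k l /andP[ky _] /andP[ly _]; apply: (reveal_ortho measF).
- by move=> k l /andP[ky _] /andP[ly _]; apply: (reveal_ortho measG).
exact: le_trans (sum_fro_reveal_mul_le parity dmin measF measG ballV) cross.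
Qed.

End Binding.

Theorem theorem7 (R : realType) (n k d r : nat) (C : {vspace bits n})
    (H : 'M['F_2]_(r, n)) (I : finType) (g : I -> bits n -> 'F_2)
    (q delta : R)
    (hC : linear_code C k d) (hH : parity_check C H)
    (hk : k%:R > 78%:R / 100%:R * n%:R :> R)
    (hg : two_universal R g)
    (hdelta : 0 < delta <= 1) :
  bcjl_binding H g q
    (2 `^ (1 / 2 * (q - d%:R / 2 + delta * n%:R + binary_entropy delta * n%:R))
     + 2 * 2 `^ (- delta * n%:R)).
Proof.
move=> a rho aq [rho_psd rho_tr] w j s.
have [_ dmin] := hC.
have [T rhoE] := psd_mx_factor rho_psd.
have T1 : fro T = 1.
  by apply: complexI; rewrite -mxtrace_adj_mul mxtrace_mulC -rhoE rho_tr.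
(* The convention P_b = 0 without openings agrees with the supremum of the empty set being 0, so
   both cases become a single supremum. *)
have probE b : opening_prob H g rho w j s b =
    sup [set p | openings H g w j s b != finset.set0 /\
      exists F, projective_measurement (openings H g w j s b) F /\
                p = success H g rho w j s b F]%classic.
  rewrite /opening_prob; case: eqP => [op0|/eqP op].
    by rewrite -[LHS]sup0; congr sup; apply/seteqP; split => // p [].
  by congr sup; apply/seteqP; split => [p Fp|p []].
rewrite !probE rhoE; apply: sup_add_le.
- by rewrite lerDl addr_ge0 ?mulr_ge0 ?powR_ge0.
- by move=> _ [_ [F [measF ->]]]; exact: success_le1.
- by move=> _ [_ [F [measF ->]]]; exact: success_le1.
move=> _ _ [_ [F [measF ->]]] [_ [G [measG ->]]].
exact: (success_add_le hH dmin).
Qed.
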